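(* Let $(\Omega,\mathcal F,(\mathcal F_t)_{t\in\mathbb N_0})$ be a filtered measurable space, $\mathcal P$ a family of probability measures on $(\Omega,\mathcal F)$, and $Q$ a probability measure on $(\Omega,\mathcal F)$. Let $(\alpha_k)_{k\ge1}$ be a decreasing sequence in $(0,1)$ with $\alpha_k\downarrow0$, put $b_k:=\log(1/\alpha_k)$, and for each $k$ let $\tau_k$ be an $(\mathcal F_t)$-stopping time with values in $\mathbb N_0\cup\{\infty\}$ such that $\sup_{P\in\mathcal P}P(\tau_k<\infty)\le\alpha_k$. Let $(w_k)_{k\ge1}$ be nonnegative weights, not all zero, with $\sum_{k=1}^\infty w_k\alpha_k\le1$. Let $I\in(0,\infty)$ and assume that $\tau_k/b_k\to 1/I$ $Q$-almost surely as $k\to\infty$. Define $$M_t:=\sum_{k=1}^\infty w_k\mathbf 1_{\{\tau_k\le t\}}\ (t\in\mathbb N_0),\qquad W(x):=\sum_{k:\,b_k\le x}w_k\ (x\ge0).$$ Suppose that $W(x)\to\infty$ as $x\to\infty$ and that, for some $\rho\in[0,1]$, $\frac{\log W(x)}{x}\to\rho$ as $x\to\infty$. Then, $Q$-almost surely as $t\to\infty$, $$\frac1t\log M_t\longrightarrow\rho I.$$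
   Context: $\mathbb N_0=\{0,1,2,\dots\}$. The process $M_t$ takes values in $[0,\infty]$, with the conventions $\log 0=-\infty$, $\log\infty=\infty$. Since $b_k\uparrow\infty$, $W(x)$ is a finite sum for each $x$. *)

(* Defs.v *)
From HB Require Import structures.
From mathcomp Require Import all_boot all_order all_algebra.
From mathcomp Require Import all_classical all_reals all_analysis.

Set Implicit Arguments.
Unset Strict Implicit.
Unset Printing Implicit Defensive.

Import Order.TTheory GRing.Theory Num.Theory.
Import numFieldNormedType.Exports.

Local Open Scope classical_set_scope.
Local Open Scope ring_scope.
Local Open Scope ereal_scope.

(* Random times take values in N_0 u {oo}, encoded as [option nat] with
   [None] for oo.  Sequences indexed by k >= 1 in the mathematics are indexed
   here from 0: index k stands for k + 1. *)

Definition time_ereal (R : realType) (s : option nat) : \bar R :=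
  if s is Some n then (n%:R)%:E else +oo.

Definition time_le (s : option nat) (t : nat) : bool :=
  if s is Some n then (n <= t)%N else false.

Definition is_filtration (d : measure_display) (T : measurableType d)
    (F : nat -> set (set T)) : Prop :=
  [/\ forall t, sigma_algebra setT (F t),
      forall t, F t `<=` measurable
    & forall s t, (s <= t)%N -> F s `<=` F t].

Definition is_stopping_time (T : Type) (F : nat -> set (set T))
    (tau : T -> option nat) : Prop :=
  forall t : nat, F t [set x | time_le (tau x) t].

Definition log_level (R : realType) (alpha : nat -> R) (k : nat) : R :=
  ln (1 / alpha k).

Definition mixture_process (R : realType) (T : Type) (w : nat -> R)
    (tau : nat -> T -> option nat) (t : nat) (x : T) : \bar R :=
  \sum_(0 <= k <oo) (w k * \1_[set y | time_le (tau k y) t] x)%:E.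

Definition cumulative_weight (R : realType) (w b : nat -> R) (x : R) : \bar R :=
  \sum_(0 <= k <oo | (b k <= x)%R) (w k)%:E.

(* Main.v *)
(* The argument is pathwise.  Fix a sample point where tau_k / b_k --> 1 / I and
   let 0 < c < I < c'.  For all but finitely many k, b_k <= c t implies
   tau_k <= t, and tau_k <= t implies b_k <= c' t; the finitely many exceptions
   contribute at most a constant C, so W(c t) - C <= M_t <= C + W(c' t).  Since
   W --> oo, the constant costs at most a factor 2 for large t, which is
   invisible after taking log and dividing by t; hence the limit points of
   log M_t / t lie in [rho c, rho c'], and c, c' can be taken arbitrarily close
   to I. *)

Require Import Defs.
From HB Require Import structures.
From mathcomp Require Import all_boot all_order all_algebra.
From mathcomp Require Import all_classical all_reals all_analysis.
From mathcomp Require Import ring lra.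

Set Implicit Arguments.
Unset Strict Implicit.
Unset Printing Implicit Defensive.

Import Order.TTheory GRing.Theory Num.Theory.
Import numFieldNormedType.Exports.

Local Open Scope classical_set_scope.
Local Open Scope ring_scope.
Local Open Scope ereal_scope.

(** Below [K] the selected weights are at most the whole head; from [K] on, [P] selects no more than
    [S]. The bound on the exceptional indices depends on [K] alone, so it serves all times [t] at
    once. *)
Lemma nneseries_le_head_add (R : realType) (w : nat -> R) (P S : pred nat)
    (K : nat) : (forall k, (0 <= w k)%R) ->
  (forall k, (K <= k)%N -> P k -> S k) ->
  \sum_(0 <= k <oo | P k) (w k)%:E <=
    (\sum_(0 <= k < K) w k)%:E + \sum_(0 <= k <oo | S k) (w k)%:E.
Proof.
move=> w0 PS.
have w0E k : 0 <= (w k)%:E by rewrite lee_fin.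
rewrite (nneseries_split_cond 0 K) ?add0n//.
apply: leeD.
  rewrite sumEFin lee_fin.
  by rewrite [X in (_ <= X)%R](bigID P)/= lerDl sumr_ge0.
rewrite [X in _ <= X](nneseries_split_cond 0 K) ?add0n//.
rewrite -[X in X <= _]add0e; apply: leeD; first exact: sume_ge0.
rewrite eseries_mkcond [X in _ <= X]eseries_mkcond.
rewrite -(nneseries_addn (f := fun k => if P k then (w k)%:E else 0)); last first.
  by move=> k; case: ifP.
rewrite -(nneseries_addn (f := fun k => if S k then (w k)%:E else 0)); last first.
  by move=> k; case: ifP.
apply: lee_nneseries => [k _ _|k _]; first by case: ifP.
case: ifPn => [Pk|_]; last by case: ifP.
by rewrite PS// leq_addl.
Qed.

Lemma mixture_processE (R : realType) (T : Type) (w : nat -> R)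
    (tau : nat -> T -> option nat) (t : nat) (x : T) :
  mixture_process w tau t x =
    \sum_(0 <= k <oo | time_le (tau k x) t) (w k)%:E.
Proof.
rewrite eseries_mkcond; apply: eq_eseriesr => k _.
rewrite indicE; case: ifPn => [h|h].
  by rewrite mem_set// mulr1.
by rewrite memNset/= ?mulr0//; apply/negP.
Qed.

(** Holds on all of [\bar R] because [lne] is -oo on nonpositive values and +oo at +oo; the cases
    M_t = 0 and M_t = oo thus need no separate treatment. *)
Lemma lt_lne (R : realType) (r : R) (y : \bar R) :
  (r%:E < lne y) = ((expR r)%:E < y).
Proof.
case: y => [y| |]/=; [|by rewrite !ltry|by []].
case: ifPn => [y0|]; last rewrite -ltNge => y0.
  by apply/esym/negbTE; rewrite -leNgt lee_fin (le_trans y0)// expR_ge0.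
by rewrite !lte_fin -{1}(expRK r) ltr_ln// posrE expR_gt0.
Qed.

Lemma lne_lt (R : realType) (r : R) (y : \bar R) :
  (lne y < r%:E) = (y < (expR r)%:E).
Proof.
case: y => [y| |]/=; [|by []|by rewrite !ltNyr].
case: ifPn => [y0|]; last rewrite -ltNge => y0.
  by rewrite ltNyr lte_fin (le_lt_trans y0)// expR_gt0.
by rewrite !lte_fin -{1}(expRK r) ltr_ln// posrE expR_gt0.
Qed.

(** Real bounds on both sides force [f] to be eventually finite, so the limit splits into two
    independent one-sided estimates. *)
Lemma cvgeP_between (R : realType) (X : Type) (F : set_system X)
    (FF : Filter F) (f : X -> \bar R) (L : R) :
  f x @[x --> F] --> L%:E <->
  (forall p : R, (p < L)%R -> \forall x \near F, p%:E < f x) /\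
  (forall q : R, (L < q)%R -> \forall x \near F, f x < q%:E).
Proof.
split=> [/fine_cvgP [ffin fL]|[fp fq]].
  split=> p pL; near=> x; have xf : f x \is a fin_num by near: x.
    by rewrite -(fineK xf) lte_fin; near: x; exact: (cvgr_gt L fL p pL).
  by rewrite -(fineK xf) lte_fin; near: x; exact: (cvgr_lt L fL p pL).
have H e : (0 < e)%R ->
    \forall x \near F, (L - e)%:E < f x < (L + e)%:E.
  move=> e0; near=> x; apply/andP; split; near: x; first apply: fp.
    by rewrite ltrBlDr ltrDl.
  by apply: fq; rewrite ltrDl.
apply/fine_cvgP; split.
  have := H _ (@ltr01 R); apply: filterS => x /andP[].
  by case: (f x).
apply/cvgrPdist_lt => e e0; have := H _ e0; apply: filterS => x /andP[].
rewrite /=; case: (f x) => [y| |]//=; rewrite !lte_fin distrC ltr_distl => -> ->//.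
Unshelve. all: by end_near.
Qed.

Lemma lt_mul_approx (R : realType) (a c p : R) : (0 <= a)%R -> (0 < c)%R ->
  (p < a * c)%R ->
  exists a' c' : R, [/\ (a' < a)%R, (0 < c')%R, (c' < c)%R & (p < a' * c')%R].
Proof.
move=> a0 c0 pac.
(* The first bound keeps c - e positive; by the second, (a - e)(c - e) > ac - e(a + c) >= (ac + p) /
   2 > p. *)
pose e := (Num.min (c / 2) ((a * c - p) / (2 * (a + c))))%R.
have ac0 : (0 < a + c)%R by lra.
have e0 : (0 < e)%R.
  by rewrite lt_min !divr_gt0 ?mulr_gt0// subr_gt0.
have e1 : (e <= c / 2)%R by rewrite ge_min lexx.
have e2 : (e * (2 * (a + c)) <= a * c - p)%R.
  by rewrite -ler_pdivlMr ?mulr_gt0// ge_min lexx orbT.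
by exists (a - e)%R, (c - e)%R; split; nra.
Qed.

Lemma gt_mul_approx (R : realType) (a c q : R) : (0 <= a)%R -> (0 < c)%R ->
  (a * c < q)%R ->
  exists a' c' : R, [/\ (a < a')%R, (c < c')%R & (a' * c' < q)%R].
Proof.
move=> a0 c0 acq.
(* As e <= 1, (a + e)(c + e) <= ac + e(a + c + 1) <= (ac + q) / 2 < q. *)
pose e := (Num.min 1 ((q - a * c) / (2 * (a + c + 1))))%R.
have ac0 : (0 < a + c + 1)%R by lra.
have e0 : (0 < e)%R.
  by rewrite lt_min ltr01 divr_gt0 ?mulr_gt0// subr_gt0.
have e1 : (e <= 1)%R by rewrite ge_min lexx.
have e2 : (e * (2 * (a + c + 1)) <= q - a * c)%R.
  by rewrite -ler_pdivlMr ?mulr_gt0// ge_min lexx orbT.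
by exists (a + e)%R, (c + e)%R; split; nra.
Qed.

Lemma near_natrM_pinfty (R : realType) (c : R) (P : set R) : (0 < c)%R ->
  (\forall x \near +oo%R, P x) -> \forall t \near \oo, P (c * t%:R)%R.
Proof.
move=> c0 HP.
have cxy : (c * x)%R @[x --> +oo%R] --> +oo%R.
  by apply: gt0_cvgMry => //; exact: cvg_id.
by have := cvgr_idn (cxy _ HP).
Qed.

(** The deterministic core: an additive error [C], which may depend on [c] but not on [t], does not
    affect the exponential rate. *)
Lemma lne_rate_transfer (R : realType) (W : R -> \bar R) (M : nat -> \bar R)
    (I rho : R) :
  (0 < I)%R -> (0 <= rho)%R ->
  W x @[x --> +oo%R] --> +oo ->
  lne (W x) * (x^-1)%:E @[x --> +oo%R] --> rho%:E ->
  (forall c : R, (0 < c < I)%R ->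
     exists C : R, forall t, W (c * t%:R)%R <= C%:E + M t) ->
  (forall c : R, (I < c)%R ->
     exists C : R, forall t, M t <= C%:E + W (c * t%:R)%R) ->
  (1 / t%:R)%:E * lne (M t) @[t --> \oo] --> (rho * I)%:E.
Proof.
move=> I0 rho0 Wy /cvgeP_between[Wgt Wlt] WM MW.
have Wge (c C : R) : (0 < c)%R -> \forall t \near \oo, C%:E <= W (c * t%:R)%R.
  move=> c0; apply: (near_natrM_pinfty (P := fun x => C%:E <= W x) c0).
  exact: cvgey_ge.
have expge (a : R) : (0 < a)%R -> \forall t \near \oo, (2 <= expR (a * t%:R))%R.
  move=> a0; apply: (near_natrM_pinfty (P := fun x => (2 <= expR x)%R) a0).
  near=> x; apply: le_trans (expR_ge1Dx x).
  by rewrite -lerBlDl; near: x; apply: nbhs_pinfty_ge; rewrite num_real.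
apply/cvgeP_between; split=> [p|q].
  move=> /(lt_mul_approx rho0 I0)[r [c [rrho c0 cI prc]]].
  have [C WMC] : exists C : R, forall t, W (c * t%:R)%R <= C%:E + M t.
    by apply: WM; rewrite c0.
  have arc : (0 < r * c - p)%R by rewrite subr_gt0.
  have Wr := near_natrM_pinfty c0 (Wgt _ rrho).
  near=> t.
  have t0 : (0 < t%:R :> R)%R by rewrite ltr0n; near: t; exact: nbhs_infty_gt.
  have ct0 : (0 < c * t%:R)%R by rewrite mulr_gt0.
  have : r%:E < lne (W (c * t%:R)%R) * ((c * t%:R)^-1)%:E by near: t.
  rewrite lte_pdivlMr// -EFinM lt_lne => Wt.
  (* Now M_t >= W(ct) - C >= W(ct) / 2 > exp(rct) / 2 >= exp(pt), the slack exp((rc - p)t) >= 2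
     paying for the factor 1/2. *)
  have WC : (2 * C)%:E <= W (c * t%:R)%R by near: t; exact: Wge.
  have := WMC t.
  rewrite div1r lte_pdivlMl// -EFinM lt_lne.
  have : (2 <= expR ((r * c - p) * t%:R))%R by near: t; exact: expge.
  have rct : (r * (c * t%:R) = t%:R * p + (r * c - p) * t%:R)%R by ring.
  rewrite rct expRD in Wt.
  have := expR_gt0 (t%:R * p)%R.
  move: Wt WC; case: (W _) => [v| |]//; case: (M t) => [m| |]//.
  - rewrite -EFinD !lte_fin !lee_fin; nra.
  - by rewrite ltry.
  - by rewrite !ltry.
move=> /(gt_mul_approx rho0 I0)[r [c [rrho cI rcq]]].
have [C MWC] := MW c cI.
have c0 : (0 < c)%R by exact: lt_trans cI.
have arc : (0 < q - r * c)%R by rewrite subr_gt0.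
have Wr := near_natrM_pinfty c0 (Wlt _ rrho).
near=> t.
have t0 : (0 < t%:R :> R)%R by rewrite ltr0n; near: t; exact: nbhs_infty_gt.
have ct0 : (0 < c * t%:R)%R by rewrite mulr_gt0.
have : lne (W (c * t%:R)%R) * ((c * t%:R)^-1)%:E < r%:E by near: t.
rewrite lte_pdivrMr// -EFinM lne_lt => Wt.
(* Symmetrically, M_t <= C + W(ct) <= 2 W(ct) < 2 exp(rct) <= exp(qt). *)
have WC : C%:E <= W (c * t%:R)%R by near: t; exact: Wge.
have := MWC t.
rewrite div1r lte_pdivrMl// -EFinM lne_lt.
have : (2 <= expR ((q - r * c) * t%:R))%R by near: t; exact: expge.
have -> : (t%:R * q = r * (c * t%:R) + (q - r * c) * t%:R)%R by ring.
rewrite expRD.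
have := expR_gt0 (r * (c * t%:R))%R.
move: Wt WC; case: (W _) => [v| |]//; case: (M t) => [m| |]//.
  rewrite -EFinD !lte_fin !lee_fin; nra.
by rewrite ltNyr.
Unshelve. all: by end_near.
Qed.

Theorem theorem3p1 (R : realType) (d : measure_display) (T : measurableType d)
  (F : nat -> set (set T)) (PP : set (probability T R)) (Q : probability T R)
  (alpha : nat -> R) (tau : nat -> T -> option nat) (w : nat -> R)
  (I rho : R)
  (F_filtration : is_filtration F)
  (alpha_range : forall k, (0 < alpha k < 1)%R)
  (alpha_decr : {homo alpha : m n / (m <= n)%N >-> (n <= m)%R})
  (alpha_cvg0 : alpha k @[k --> \oo] --> (0 : R)%R)
  (tau_stopping : forall k, is_stopping_time F (tau k))
  (tau_level : forall k,
     ereal_sup [set (P : probability T R) [set x | tau k x <> None] | P in PP]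
       <= (alpha k)%:E)
  (w_ge0 : forall k, (0 <= w k)%R)
  (w_neq0 : exists k, w k <> 0%R)
  (w_budget : \sum_(0 <= k <oo) (w k * alpha k)%:E <= 1)
  (I_gt0 : (0 < I)%R)
  (tau_rate : {ae Q, forall x,
     time_ereal R (tau k x) * ((log_level alpha k)^-1)%:E @[k --> \oo]
       --> (1 / I)%:E})
  (W_cvgy : cumulative_weight w (log_level alpha) x @[x --> +oo%R] --> +oo)
  (rho_range : (0 <= rho <= 1)%R)
  (W_rate : lne (cumulative_weight w (log_level alpha) x) * (x^-1)%:E
              @[x --> +oo%R] --> rho%:E) :
  {ae Q, forall x,
     (1 / t%:R)%:E * lne (mixture_process w tau t x) @[t --> \oo]
       --> (rho * I)%:E}.
Proof.
apply: filterS tau_rate => x /cvgeP_between[tau_gt tau_lt].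
have b0 k : (0 < log_level alpha k)%R.
  have /andP[a0 a1] := alpha_range k.
  by rewrite /log_level ln_gt0// div1r invf_gt1.
have [rho0 _] := andP rho_range.
apply: (lne_rate_transfer I_gt0 rho0 W_cvgy W_rate) => [c /andP[c0 cI]|c cI].
  (* Eventually tau_k < b_k / c, which also makes tau_k finite; hence b_k <= ct yields tau_k <= t.
     The constant is the total weight of the indices before that. *)
  have : (1 / I < 1 / c)%R by rewrite !div1r ltf_pV2.
  move=> /tau_lt[K _ HK]; exists (\sum_(0 <= k < K) w k)%R => t.
  rewrite mixture_processE; apply: nneseries_le_head_add => // k Kk bk.
  have := HK k Kk; rewrite /= lte_pdivrMr//.
  case: (tau k x) => [n|]//=; rewrite -EFinM lte_fin => nk.
  rewrite -(ler_nat R) (le_trans (ltW nk))//.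
  by rewrite div1r ler_pdivrMl.
have c0 : (0 < c)%R by exact: lt_trans cI.
(* Eventually b_k / c < tau_k, so tau_k <= t yields b_k <= ct; an infinite tau_k is excluded by
   tau_k <= t. *)
have : (1 / c < 1 / I)%R by rewrite !div1r ltf_pV2.
move=> /tau_gt[K _ HK]; exists (\sum_(0 <= k < K) w k)%R => t.
rewrite mixture_processE; apply: nneseries_le_head_add => // k Kk tk.
have := HK k Kk; rewrite /= lte_pdivlMr//.
case: (tau k x) tk => [n|]//= nt; rewrite -EFinM lte_fin => nk.
rewrite -ler_pdivrMl// -div1r (le_trans (ltW nk))//.
by rewrite ler_nat.
Qed.
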